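(* Let $G$ and $H$ be finite graphs and let $D$ be a dominating set of $G\Box H$. If there exist dominating sets $S_1$ and $S_2$ of $G$ such that for every $h\in V(H)$ we have $S_i\in M_G(p_G(D\cap G_h))$ for some $i\in\{1,2\}$, then $|D|\geq \gamma(G)\gamma(H)$.
   Context: $\gamma(X)$ denotes the domination number of a graph $X$ (the minimum size of a dominating set). $G\Box H$ is the Cartesian product of $G$ and $H$. For $h\in V(H)$, $G_h=\{(g,h)\mid g\in V(G)\}$ is the $G$-layer at $h$. The projection $p_G:V(G\Box H)\to V(G)$ is $p_G(g,h)=g$. For $X\subseteq V(G)$, a minimal dominating set of $G$ containing $X$ is a dominating set $S$ of $G$ with $X\subseteq S$ such that no set $S'$ with $X\subseteq S'\subsetneq S$ is a dominating set of $G$; $M_G(X)$ denotes the set of all minimal dominating sets of $G$ containing $X$. *)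

(* Defs.v *)
From mathcomp Require Import all_boot.

Set Implicit Arguments.
Unset Strict Implicit.
Unset Printing Implicit Defensive.

(* The vertex set may be empty. *)
Record sgraph := SGraph {
  vertex :> finType;
  adj : rel vertex;
  adj_sym : symmetric adj;
  adj_irrefl : irreflexive adj
}.

Section CartesianProduct.
Variables G H : sgraph.

Definition cart_adj : rel (G * H) :=
  fun x y => ((x.1 == y.1) && adj x.2 y.2) || (adj x.1 y.1 && (x.2 == y.2)).

Lemma cart_adj_sym : symmetric cart_adj.
Proof.
move=> x y; rewrite /cart_adj (adj_sym x.1) (adj_sym x.2).
by rewrite (eq_sym x.1) (eq_sym x.2).
Qed.

Lemma cart_adj_irrefl : irreflexive cart_adj.
Proof. by move=> x; rewrite /cart_adj !adj_irrefl andbF. Qed.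

Definition cart_prod : sgraph := SGraph cart_adj_sym cart_adj_irrefl.

Definition layer (h : H) : {set cart_prod} := [set x : cart_prod | x.2 == h].

Definition proj (x : cart_prod) : G := x.1.

End CartesianProduct.

Section Domination.
Variable G : sgraph.

Definition dominating (S : {set G}) : bool :=
  [forall v, (v \in S) || [exists u in S, adj u v]].

(* The default [set: G] of the minimum is always dominating. *)
Definition domination_number : nat :=
  #|[arg min_(S < [set: G] | dominating S) #|S|]|.

(* M_G(X) *)
Definition min_dominating_sets (X : {set G}) : {set {set G}} :=
  [set S : {set G} | minset (fun T : {set G} => (X \subset T) && dominating T) S].

End Domination.

Arguments domination_number G : clear implicits.

(* Main.v *)
Require Import Defs.
From mathcomp Require Import all_boot.

(** Split [V(H)] into [K1] and [K2] so that [Si] is a minimal dominating set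
    over the layer of [D] at each [h] in [Ki]; write [fiber D g K] for the set
    of [h] in [K] with [(g, h)] in [D].  If [s] in [S1] is missing from some
    layer over [K1], then [s] has a private neighbour [v] with respect to [S1],
    and [(v, h)] can only be dominated from inside the [H]-layer of [v].  Hence
    either [fiber D s K1] alone dominates [K1], or [v] lies in [S2] and
    [fiber D s K1], [fiber D v K2] together dominate [K1]; symmetrically for
    [S2].  Assigning such partners yields a matching between [S1] and [S2]:
    if [v] in turn needs a partner in [S1], that partner is adjacent or equal
    to [v], so it is [s], because [v] is private to [s].  Any extension of
    this matching to [min(|S1|, |S2|)] pairs [(s, t)] gives that many disjoint
    pieces of [D], each projecting to a dominating set
    [fiber D s K1 :|: fiber D t K2] of [H]. *)

Set Implicit Arguments.
Unset Strict Implicit.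
Unset Printing Implicit Defensive.

(** * Domination of single vertices and private neighbours *)

Section DominatedBy.
Variable G : sgraph.

Definition dominated_by (S : {set G}) (v : G) : bool :=
  (v \in S) || [exists u in S, adj u v].

(** For [s] in [S], this is a private neighbour in the closed sense: [v = s] is allowed. *)
Definition private (S : {set G}) (s v : G) : bool :=
  [forall u in S, ((u == v) || adj u v) == (u == s)].

Lemma dominated_byP (S : {set G}) (v : G) :
  reflect (exists2 u, u \in S & (u == v) || adj u v) (dominated_by S v).
Proof.
apply: (iffP orP) => [[vS | /exists_inP[u uS uv]] | [u uS /orP[/eqP<- | uv]]].
- by exists v; rewrite ?eqxx.
- by exists u; rewrite ?uv ?orbT.
- by left.
- by right; apply/exists_inP; exists u.
Qed.

Lemma dominated_byS (A B : {set G}) (v : G) :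
  A \subset B -> dominated_by A v -> dominated_by B v.
Proof.
move=> /subsetP sAB /dominated_byP[u uA uv].
by apply/dominated_byP; exists u; first exact: sAB.
Qed.

Lemma domination_number_le (S : {set G}) :
  dominating S -> domination_number G <= #|S|.
Proof.
rewrite /domination_number; case: arg_minnP => [|T _ Tmin]; last exact: Tmin.
by apply/forallP=> v; rewrite inE.
Qed.

Lemma private_inj (S : {set G}) (s s' v : G) :
  s \in S -> private S s v -> private S s' v -> s = s'.
Proof.
move=> sS /forall_inP/(_ s sS); rewrite eqxx => /eqP sv.
by move=> /forall_inP/(_ s sS); rewrite sv => /eqP/esym/eqP.
Qed.

(** Privacy of [s'] to [t] makes the two equal or adjacent, so [s'] dominates [t], whose only
    dominator in [S1] is [s]. *)
Lemma private_mutual (S1 S2 : {set G}) (s s' t : G) :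
  s' \in S1 -> private S1 s t -> t \in S2 -> private S2 t s' -> s' = s.
Proof.
move=> s'S /forall_inP/(_ s' s'S)/eqP E tS /forall_inP/(_ t tS).
by rewrite eqxx (eq_sym t) adj_sym E => /eqP/eqP.
Qed.

(** A vertex that [S :\ s] misses is still dominated by [S], hence by [s] alone. *)
Lemma private_exists (S : {set G}) (s : G) :
    dominating S -> s \in S -> ~~ dominating (S :\ s) ->
  exists v, private S s v.
Proof.
move=> domS sS /forallPn[v nv]; exists v; apply/forall_inP=> u uS.
have /dominated_byP[w wS wv] : dominated_by S v by exact: (forallP domS).
have priv x : x \in S -> (x == v) || adj x v -> x = s.
  move=> xS xv; apply/eqP; apply: contraNT nv => xs.
  by apply/dominated_byP; exists x; rewrite // !inE xs.
have [->|us] := eqVneq u s; first by rewrite -(priv w wS wv) wv.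
by apply/eqP/negbTE; apply: contraNN us => uv; rewrite (priv u).
Qed.

End DominatedBy.

(** * Matchings between two vertex sets *)

Section Matchings.
Variable T : finType.

(** The graph of a partial injection from [S1] to [S2]. A vertex of both sets may occur once on each
    side. *)
Definition matching (S1 S2 : {set T}) (M : {set T * T}) : bool :=
  [forall p in M, (p.1 \in S1) && (p.2 \in S2)] &&
  [forall p in M, forall q in M, (p.1 == q.1) == (p.2 == q.2)].

Lemma matchingP (S1 S2 : {set T}) (M : {set T * T}) :
  reflect ((forall s t, (s, t) \in M -> s \in S1 /\ t \in S2) /\
           {in M &, forall p q, (p.1 == q.1) = (p.2 == q.2)})
          (matching S1 S2 M).
Proof.
apply: (iffP andP) => [[/forall_inP sub /forall_inP inj] | [sub inj]].
  split=> [s t /sub/andP[] // | p q pM qM].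
  by have /forall_inP/(_ q qM)/eqP := inj p pM.
split; apply/forall_inP=> p pM.
  by apply/andP/sub; rewrite -surjective_pairing.
by apply/forall_inP=> q qM; rewrite inj.
Qed.

Lemma matching_inj1 (S1 S2 : {set T}) (M : {set T * T}) :
  matching S1 S2 M -> {in M &, injective fst}.
Proof.
move=> /matchingP[_ inj] [a b] [c d] pM qM /= eq1.
by have := inj _ _ pM qM; rewrite /= eq1 eqxx => /esym/eqP->.
Qed.

Lemma matching_inj2 (S1 S2 : {set T}) (M : {set T * T}) :
  matching S1 S2 M -> {in M &, injective snd}.
Proof.
move=> /matchingP[_ inj] [a b] [c d] pM qM /= eq2.
by have := inj _ _ pM qM; rewrite /= eq2 eqxx => /eqP->.
Qed.

Lemma matching_extend (S1 S2 : {set T}) (M : {set T * T}) :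
    matching S1 S2 M ->
  exists M' : {set T * T},
    [/\ M \subset M', matching S1 S2 M' & minn #|S1| #|S2| <= #|M'|].
Proof.
move=> mM; have [M' /maxsetP[mM' maxM'] sMM'] := maxset_exists mM.
exists M'; split=> //; rewrite leqNgt leq_min; apply/negP=> /andP[lt1 lt2].
have fresh (f : T * T -> T) (S : {set T}) :
    #|M'| < #|S| ->
    exists2 x, x \in S & forall p, p \in M' -> (f p == x) = false.
  move=> lt; have /subsetPn[x xS xM] : ~~ (S \subset f @: M').
    apply/negP=> /subset_leq_card; rewrite leqNgt.
    by rewrite (leq_ltn_trans (leq_imset_card _ _) lt).
  exists x => // p pM; apply/negbTE; apply: contraNneq xM => <-.
  exact: imset_f.
have [s sS sM] := fresh fst _ lt1; have [t tS tM] := fresh snd _ lt2.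
have /maxM' /(_ (subsetUr _ _)) eqM : matching S1 S2 ((s, t) |: M').
  have /matchingP[sub inj] := mM'; apply/matchingP; split=> [a b | p q].
    by rewrite !inE => /predU1P[[-> ->] | /sub].
  rewrite !inE => /predU1P[-> | pM] /predU1P[-> | qM] /=.
  - by rewrite !eqxx.
  - by rewrite eq_sym sM // eq_sym tM.
  - by rewrite sM // tM.
  - exact: inj.
by have := sM (s, t); rewrite -eqM setU11 eqxx => /(_ isT).
Qed.

(** Take all pairs proposed by [g1] or by [g2]. Two pairs from the same map agree by injectivity or
    functionality; a pair from each sharing an end agree by the last two hypotheses. *)
Lemma matching_of_partners (S1 S2 : {set T}) (g1 g2 : T -> option T) :
    (forall s t, s \in S1 -> g1 s = Some t -> t \in S2) ->
    (forall s t, t \in S2 -> g2 t = Some s -> s \in S1) ->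
    (forall s s' t, s \in S1 -> s' \in S1 ->
       g1 s = Some t -> g1 s' = Some t -> s = s') ->
    (forall t t' s, t \in S2 -> t' \in S2 ->
       g2 t = Some s -> g2 t' = Some s -> t = t') ->
    (forall s t s', s \in S1 -> g1 s = Some t -> g2 t = Some s' -> s' = s) ->
    (forall t s t', t \in S2 -> g2 t = Some s -> g1 s = Some t' -> t' = t) ->
  exists2 M, matching S1 S2 M &
    (forall s t, s \in S1 -> g1 s = Some t -> (s, t) \in M) /\
    (forall s t, t \in S2 -> g2 t = Some s -> (s, t) \in M).
Proof.
move=> sub1 sub2 inj1 inj2 mutual1 mutual2.
pose M := [set p | (p.1 \in S1) && (p.2 \in S2) &&
                   ((g1 p.1 == Some p.2) || (g2 p.2 == Some p.1))].
exists M; last first.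
  split=> s t xS gx; rewrite inE /= gx eqxx ?orbT andbT xS ?andbT /=.
    exact: sub1 gx.
  exact: sub2 gx.
apply/matchingP; split=> [s t | [a b] [c d]]; rewrite !inE /=.
  by case/andP=> /andP[].
move=> /andP[/andP[aS bS] /orP[]/eqP gab] /andP[/andP[cS dS] /orP[]/eqP gcd];
  apply/eqP/eqP => [eac | ebd]; subst.
- by move: gcd; rewrite gab => -[].
- exact: inj1 gab gcd.
- exact: mutual2 dS gcd gab.
- exact/esym/(mutual1 _ _ _ aS gab gcd).
- exact/esym/(mutual2 _ _ _ bS gab gcd).
- exact: mutual1 cS gcd gab.
- exact: inj2 gab gcd.
- by move: gcd; rewrite gab => -[].
Qed.

End Matchings.

(** * Fibres of [D], partners, and the count of [D] *)

Section Fibers.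
Variables (G H : sgraph) (D : {set cart_prod G H}).

Definition fiber (g : G) (K : {set H}) : {set H} := [set h in K | (g, h) \in D].

Lemma sum_card_fiber (K1 K2 : {set H}) :
  [disjoint K1 & K2] -> \sum_g #|fiber g K1| + \sum_g #|fiber g K2| <= #|D|.
Proof.
move=> dis; have -> : #|D| = \sum_g \sum_h ((g, h) \in D).
  rewrite pair_bigA /= -sum1_card big_mkcond /=.
  by apply: eq_bigr => -[g h] _; case: (_ \in D).
rewrite -big_split /=; apply: leq_sum => g _.
rewrite -!sum1_card !(big_mkcond (fun h => h \in fiber _ _)) -big_split /=.
apply: leq_sum => h _; rewrite !inE.
have [hK | _] := boolP (h \in K1).
  by rewrite (disjointFr dis hK); case: (_ \in D).
by case: (h \in K2); case: (_ \in D).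
Qed.

Definition layer_min (S : {set G}) (h : H) : Prop :=
  S \in min_dominating_sets (@proj G H @: (D :&: layer G h)).

Lemma mem_proj_layer (g : G) (h : H) :
  (g \in @proj G H @: (D :&: layer G h)) = ((g, h) \in D).
Proof.
apply/imsetP/idP=> [[[g' h'] /=] | gD]; last first.
  by exists (g, h); rewrite // !inE gD /=.
by rewrite !inE /= => /andP[xD /eqP<-] ->.
Qed.

Lemma layer_min_mem (S : {set G}) (g : G) (h : H) :
  layer_min S h -> (g, h) \in D -> g \in S.
Proof.
rewrite /layer_min inE => /minsetp/andP[/subsetP sub _] gD.
by apply: sub; rewrite mem_proj_layer.
Qed.

(** Here [S :\ s] still contains the projected layer, so minimality of [S] forbids it to
    dominate. *)
Lemma layer_min_nondom (S : {set G}) (s : G) (h : H) :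
  layer_min S h -> s \in S -> (s, h) \notin D -> ~~ dominating (S :\ s).
Proof.
rewrite /layer_min inE => /minsetP[/andP[sub _] Smin] sS sD.
apply/negP=> dom; have : S :\ s = S.
  apply: Smin (subD1set _ _); rewrite dom andbT.
  by rewrite subsetD1 sub mem_proj_layer.
by move=> /setP/(_ s); rewrite !inE eqxx sS.
Qed.

(** A private neighbour of [s] depends on [S1] only, not on the layer, so one found at a single [h0]
    serves all of [K1]. *)
Lemma partner_exists (S1 S2 : {set G}) (K1 K2 : {set H}) (s : G) :
    dominating D -> dominating S1 -> K1 :|: K2 = [set: H] ->
    {in K1, forall h, layer_min S1 h} -> {in K2, forall h, layer_min S2 h} ->
    s \in S1 ->
    {in K1, forall h, dominated_by (fiber s K1) h} \/
    exists t, [/\ t \in S2, private S1 s t &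
      {in K1, forall h, dominated_by (fiber s K1 :|: fiber t K2) h}].
Proof.
move=> domD domS1 K12 min1 min2 sS.
have [full | /forall_inPn[h0 h0K sh0]] :=
  boolP [forall h in K1, (s, h) \in D].
  left=> h hK; apply/dominated_byP; exists h; last by rewrite eqxx.
  by rewrite inE hK (forall_inP full).
have [v privv] :=
  private_exists domS1 sS (layer_min_nondom (min1 _ h0K) sS sh0).
have priv u : u \in S1 -> (u == v) || adj u v -> u = s.
  by move=> uS uv; have := forall_inP privv u uS; rewrite uv => /eqP/esym/eqP.
(* A vertex [(u, h)] of [D] with [u] equal or adjacent to [v] would have [u] in [S1], so [u = s],
   against [(s, h) \notin D]. *)
have vert h : h \in K1 -> (s, h) \notin D ->
    exists2 h', (v, h') \in D & adj h' h.
  move=> hK sD; have nD u : (u == v) || adj u v -> (u, h) \notin D.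
    move=> uv; apply: contraNN sD => uD.
    by rewrite -(priv u _ uv) // (layer_min_mem (min1 _ hK) uD).
  have /dominated_byP[[u h'] uD] :
    @dominated_by (cart_prod G H) D (v, h) by exact: (forallP domD).
  case/or3P=> [/eqP[? ?] | /= /andP[/eqP ? hh] | /= /andP[uv /eqP ?]]; subst.
  - by have := nD v; rewrite eqxx uD => /(_ isT).
  - by exists h'.
  - by have := nD u; rewrite uv orbT uD => /(_ isT).
have K1v h : h \in K1 -> (v, h) \in D -> v = s.
  by move=> hK vD; rewrite (priv v) ?eqxx // (layer_min_mem (min1 _ hK) vD).
(* If [v] is not in [S2], no vertex [(v, h')] of [D] lies over [K2]; over [K1], such a vertex forces
   [v = s]. *)
have [vS2 | nvS2] := boolP (v \in S2); [right; exists v; split=> // | left];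
    move=> h hK; apply/dominated_byP; have [sD | sD] := boolP ((s, h) \in D);
    try by exists h; rewrite ?eqxx // !inE hK sD.
  have [h' vD hh] := vert h hK sD; exists h'; rewrite ?hh ?orbT // !inE.
  have := in_setT h'; rewrite -K12 inE vD => /orP[h'K | ->]; last first.
    by rewrite orbT.
  by rewrite h'K -(K1v _ h'K vD) vD.
have [h' vD hh] := vert h hK sD; exists h'; rewrite ?hh ?orbT // !inE.
have := in_setT h'; rewrite -K12 inE => /orP[h'K | h'K].
  by rewrite h'K -(K1v _ h'K vD) vD.
by rewrite (layer_min_mem (min2 _ h'K) vD) in nvS2.
Qed.

(** A vertex whose own fibre suffices claims no partner. A failed search also gives [None], but
    [partner_exists] rules it out. *)
Definition partner (S1 S2 : {set G}) (K1 K2 : {set H}) (s : G) : option G :=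
  if [forall h in K1, dominated_by (fiber s K1) h] then None else
  [pick t | [&& t \in S2, private S1 s t &
     [forall h in K1, dominated_by (fiber s K1 :|: fiber t K2) h]]].

Lemma partner_some (S1 S2 : {set G}) (K1 K2 : {set H}) (s t : G) :
    partner S1 S2 K1 K2 s = Some t ->
  [/\ t \in S2, private S1 s t &
    {in K1, forall h, dominated_by (fiber s K1 :|: fiber t K2) h}].
Proof.
rewrite /partner; case: ifP => // _.
by case: pickP => // t' /and3P[tS privt /forall_inP dom] [<-].
Qed.

Lemma partner_none (S1 S2 : {set G}) (K1 K2 : {set H}) (s : G) :
    dominating D -> dominating S1 -> K1 :|: K2 = [set: H] ->
    {in K1, forall h, layer_min S1 h} -> {in K2, forall h, layer_min S2 h} ->
    s \in S1 -> partner S1 S2 K1 K2 s = None ->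
  {in K1, forall h, dominated_by (fiber s K1) h}.
Proof.
move=> domD domS1 K12 min1 min2 sS; rewrite /partner.
case: ifP => [/forall_inP // | _]; case: pickP => // none _.
have [//|[t [tS privt dom]]] := partner_exists domD domS1 K12 min1 min2 sS.
by have := none t; rewrite tS privt; move/forall_inP: dom => ->.
Qed.

Lemma dominating_pairs (S1 S2 : {set G}) (K1 K2 : {set H}) :
    dominating D -> dominating S1 -> dominating S2 -> K1 :|: K2 = [set: H] ->
    {in K1, forall h, layer_min S1 h} -> {in K2, forall h, layer_min S2 h} ->
  exists M, [/\ matching S1 S2 M, minn #|S1| #|S2| <= #|M| &
    {in M, forall p, dominating (fiber p.1 K1 :|: fiber p.2 K2)}].
Proof.
move=> domD domS1 domS2 K12 min1 min2; have K21 := K12; rewrite setUC in K21.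
pose g1 := partner S1 S2 K1 K2; pose g2 := partner S2 S1 K2 K1.
have [||||||M0 mM0 [M01 M02]] := @matching_of_partners _ S1 S2 g1 g2.
- by move=> s t _ /partner_some[].
- by move=> s t _ /partner_some[].
- move=> s s' t sS _ /partner_some[_ p _] /partner_some[_ p' _].
  exact: private_inj p p'.
- move=> s s' t sS _ /partner_some[_ p _] /partner_some[_ p' _].
  exact: private_inj p p'.
- move=> s t s' sS /partner_some[tS p _] /partner_some[s'S p' _].
  exact: private_mutual p tS p'.
- move=> s t s' sS /partner_some[tS p _] /partner_some[s'S p' _].
  exact: private_mutual p tS p'.
have [M [/subsetP sM mM leM]] := matching_extend mM0.
exists M; split=> // -[s t] pM /=; have /matchingP[/(_ s t pM)[sS tS] _] := mM.
apply/forallP=> h; have := in_setT h; rewrite -K12 inE => /orP[hK | hK].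
  case E: (g1 s) => [t'|]; last first.
    apply: dominated_byS (subsetUl _ _) _.
    exact: (partner_none domD domS1 K12 min1 min2 sS E).
  (* The forced pair [(s, t')] is in [M] as well, hence [t' = t]. *)
  have [<-] := matching_inj1 mM (sM _ (M01 _ _ sS E)) pM erefl.
  by have [_ _] := partner_some E; apply.
case E: (g2 t) => [s'|]; last first.
  apply: dominated_byS (subsetUr _ _) _.
  exact: (partner_none domD domS2 K21 min2 min1 tS E).
have [<-] := matching_inj2 mM (sM _ (M02 _ _ tS E)) pM erefl.
by rewrite setUC; have [_ _] := partner_some E; apply.
Qed.

(** Each vertex occurs at most once per side of [M]; if on both, its two fibres lie over the
    disjoint [K1] and [K2]. *)
Lemma sum_card_matching_fiber (S1 S2 : {set G}) (K1 K2 : {set H})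
    (M : {set G * G}) :
    matching S1 S2 M -> [disjoint K1 & K2] ->
  \sum_(p in M) #|fiber p.1 K1 :|: fiber p.2 K2| <= #|D|.
Proof.
move=> mM dis; apply: leq_trans (sum_card_fiber dis).
apply: (@leq_trans (\sum_(p in M) (#|fiber p.1 K1| + #|fiber p.2 K2|))).
  by apply: leq_sum => p _; rewrite cardsU leq_subr.
have le (f : G * G -> G) (K : {set H}) : {in M &, injective f} ->
    \sum_(p in M) #|fiber (f p) K| <= \sum_g #|fiber g K|.
  move=> injf; rewrite -(big_imset (fun g => #|fiber g K|)) //= big_mkcond /=.
  by apply: leq_sum => g _; case: ifP.
rewrite big_split /= leq_add ?le //.
  exact: matching_inj1 mM.
exact: matching_inj2 mM.
Qed.

End Fibers.

Theorem theorem2 (G H : sgraph) (D : {set cart_prod G H})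
    (D_dom : dominating D)
    (S12 : exists S1 S2 : {set G},
       [/\ dominating S1, dominating S2 &
           forall h : H,
             S1 \in min_dominating_sets (@proj G H @: (D :&: layer G h)) \/
             S2 \in min_dominating_sets (@proj G H @: (D :&: layer G h))]) :
  domination_number G * domination_number H <= #|D|.
Proof.
case: S12 => S1 [S2 [dom1 dom2 min12]].
(* Any [h] for which both sets qualify goes to [K], which keeps the two parts disjoint. *)
pose K := [set h | S1 \in min_dominating_sets (@proj G H @: (D :&: layer G h))].
have min1 : {in K, forall h, layer_min D S1 h} by move=> h; rewrite in_set.
have min2 : {in ~: K, forall h, layer_min D S2 h}.
  by move=> h; rewrite in_setC in_set => /negP nS1; case: (min12 h).
have [M [mM leM domM]] := dominating_pairs D_dom dom1 dom2 (setUCr K) min1 min2.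
have dis : [disjoint K & ~: K] by rewrite -setI_eq0 setICr.
apply: leq_trans (sum_card_matching_fiber D mM dis).
apply: (@leq_trans (#|M| * domination_number H)).
  by rewrite leq_mul2r (leq_trans _ leM) ?orbT // leq_min !domination_number_le.
rewrite -sum_nat_const; apply: leq_sum => p pM.
exact/domination_number_le/domM.
Qed.
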